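(* Let $\mathcal{B}$ be a swap structure for $\mathbf{mbC}$. Then there exist a set $I$ and a monomorphism of multialgebras $\hat h:\mathcal{B}\to\prod_{i\in I}\mathcal{B}_{\mathbb{A}_2}^{\mathbf{mbC}}$.
   Context: Let $\Sigma=\{\wedge,\vee,\to,\neg,\circ\}$, with $\wedge,\vee,\to$ binary and $\neg,\circ$ unary. A multialgebra over $\Sigma$ is a nonempty set $B$ with, for each $n$-ary symbol $c$, a function $c^{\mathcal{B}}:B^n\to\wp(B)\setminus\{\emptyset\}$; $|\mathcal{B}|=B$ is its domain. A homomorphism $f:\mathcal{A}\to\mathcal{B}$ is a function between the domains with $f[c^{\mathcal{A}}(\vec a)]\subseteq c^{\mathcal{B}}(f(\vec a))$ for all $c$ and $\vec a$. These form the category $\mathbf{MAlg}(\Sigma)$; a monomorphism of multialgebras is a monomorphism in this category. The product $\prod_{i\in I}\mathcal{A}_i$ has as domain the cartesian product of the domains and multioperations $c(\vec a)=\prod_{i\in I}c^{\mathcal{A}_i}(\pi_i(\vec a))$ (for $I=\emptyset$ it is the one-element multialgebra). For a Boolean algebra $\mathcal{A}$ with domain $A$ (the one-element Boolean algebra is allowed) and $z\in A^3$ write $z=(z_1,z_2,z_3)$. Put $\mathrm{B}_{\mathcal{A}}^{\mathbf{mbC}}=\{z\in A^3 : z_1\vee z_2=1 \text{ and } z_1\wedge z_2\wedge z_3=0\}$. A swap structure for $\mathbf{mbC}$ over $\mathcal{A}$ is a multialgebra $\mathcal{B}$ over $\Sigma$ with domain $B\subseteq \mathrm{B}_{\mathcal{A}}^{\mathbf{mbC}}$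 such that $0\in\{z_1: z\in B\}$ and for all $z,w\in B$: (i) $\emptyset\ne z\#w\subseteq\{u\in B: u_1=z_1\# w_1\}$ for $\#\in\{\wedge,\vee,\to\}$; (ii) $\emptyset\neq\neg z\subseteq\{u\in B:u_1=z_2\}$; (iii) $\emptyset\ne\circ z\subseteq\{u\in B:u_1=z_3\}$. A swap structure for $\mathbf{mbC}$ is one over some Boolean algebra. The full swap structure $\mathcal{B}_{\mathcal{A}}^{\mathbf{mbC}}$ has domain $\mathrm{B}_{\mathcal{A}}^{\mathbf{mbC}}$ and equality in the right-hand inclusions of (i)–(iii). $\mathbb{A}_2$ is the two-element Boolean algebra. *)

(* Defs.v *)
From HB Require Import structures.
From mathcomp Require Import all_boot all_order.
From mathcomp Require Import boolp classical_sets.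

Set Implicit Arguments.
Unset Strict Implicit.
Unset Printing Implicit Defensive.

Import Order.Theory.
Local Open Scope classical_set_scope.

Inductive connective := Conj | Disj | Impl | Neg | Circ.

Definition arity (c : connective) : nat :=
  match c with Conj | Disj | Impl => 2 | Neg | Circ => 1 end.

Record multialgebra := Multialgebra {
  domain :> Type;
  domain_inhabited : inhabited domain;
  mop : forall c : connective, (arity c).-tuple domain -> set domain;
  mop_nonempty : forall c (a : (arity c).-tuple domain), mop a !=set0
}.

Record mhom (A B : multialgebra) := MHom {
  mhom_fun :> A -> B;
  mhom_mop : forall c (a : (arity c).-tuple A),
    mhom_fun @` mop a `<=` mop (map_tuple mhom_fun a)
}.

(* Left cancellability in the category of multialgebras; two homomorphisms
   are identified when their underlying functions agree. *)
Definition monomorphism (A B : multialgebra) (h : mhom A B) : Prop :=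
  forall (C : multialgebra) (f g : mhom C A), h \o f =1 h \o g -> f =1 g.

Section Product.
Variables (I : Type) (A : I -> multialgebra).

Definition prod_mop (c : connective) (a : (arity c).-tuple (forall i, A i)) :
    set (forall i, A i) :=
  [set x | forall i, mop (map_tuple (fun y => y i) a) (x i)].

Lemma prod_inhabited : inhabited (forall i, A i).
Proof.
have H i : {x : A i | True}.
  by apply: cid; case: (domain_inhabited (A i)) => x; exists x.
exact: (inhabits (fun i => sval (H i))).
Qed.

Lemma prod_mop_nonempty c a : @prod_mop c a !=set0.
Proof.
have H i := cid (@mop_nonempty (A i) c (map_tuple (fun y => y i) a)).
by exists (fun i => sval (H i)) => i; exact: svalP (H i).
Qed.

Definition mprod : multialgebra :=
  Multialgebra prod_inhabited prod_mop_nonempty.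

End Product.

(* MathComp's complemented distributive lattices with bottom and top are the
   Boolean algebras; \bot = \top is not excluded. *)
Section Swap.
Context {d : Order.disp_t} (A : ctbDistrLatticeType d).
Local Open Scope order_scope.

Definition snap1 (z : A * A * A) : A := z.1.1.
Definition snap2 (z : A * A * A) : A := z.1.2.
Definition snap3 (z : A * A * A) : A := z.2.

Definition snapshots : set (A * A * A) :=
  [set z | snap1 z `|` snap2 z = \top /\
           (snap1 z `&` snap2 z) `&` snap3 z = \bot].

(* The first coordinate prescribed for every value of a multioperation. *)
Definition value1 (c : connective) : (arity c).-tuple (A * A * A) -> A :=
  match c with
  | Conj => fun a => snap1 (tnth a ord0) `&` snap1 (tnth a ord_max)
  | Disj => fun a => snap1 (tnth a ord0) `|` snap1 (tnth a ord_max)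
  | Impl => fun a => (~` snap1 (tnth a ord0)) `|` snap1 (tnth a ord_max)
  | Neg => fun a => snap2 (tnth a ord0)
  | Circ => fun a => snap3 (tnth a ord0)
  end.

Record swap_structure := SwapStructure {
  swap_dom : set (A * A * A);
  swap_dom_sub : (swap_dom `<=` snapshots)%classic;
  swap_bot : (snap1 @` swap_dom)%classic \bot;
  swap_mop : forall c, (arity c).-tuple swap_dom -> set swap_dom;
  swap_mop_nonempty : forall c (a : (arity c).-tuple swap_dom), (swap_mop a !=set0)%classic;
  swap_mop_value : forall c (a : (arity c).-tuple swap_dom),
    (swap_mop a `<=`
      [set u | snap1 (val u) = value1 (map_tuple val a)])%classic
}.

Lemma swap_inhabited (B : swap_structure) : inhabited (swap_dom B).
Proof. by case: (swap_bot B) => z Bz _; exists; exists z; exact: mem_set. Qed.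

Definition multialgebra_of_swap (B : swap_structure) : multialgebra :=
  Multialgebra (swap_inhabited B) (@swap_mop_nonempty B).

Lemma snapshots_surj (x : A) : (x, ~` x, \bot) \in snapshots.
Proof. by apply/mem_set; rewrite /snapshots /= /snap1 /snap2 /snap3 /= joinxC meetx0.
Qed.

Definition full_mop (c : connective) (a : (arity c).-tuple snapshots) :
    set snapshots :=
  [set u | snap1 (val u) = value1 (map_tuple val a)]%classic.

Lemma full_bot : (snap1 @` snapshots)%classic \bot.
Proof. by exists (\bot, ~` \bot, \bot) => //; exact/set_mem/snapshots_surj. Qed.

Lemma full_mop_nonempty c a : (@full_mop c a !=set0)%classic.
Proof. by exists (SigSub (snapshots_surj (value1 (map_tuple val a)))). Qed.

Definition full_swap_structure : swap_structure :=
  @SwapStructure snapshots (fun z Hz => Hz) full_bot full_mop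
    full_mop_nonempty (fun c a u Hu => Hu).

End Swap.

Coercion multialgebra_of_swap : swap_structure >-> multialgebra.

(* Main.v *)
(* By the Boolean prime ideal theorem, the homomorphisms from a Boolean algebra
   into the two-element one separate points.  Applying each of them
   coordinatewise to the snapshots of B gives a family of homomorphisms of
   multialgebras from B into the full swap structure over the two-element
   algebra: the full structure imposes nothing but the first coordinate of the
   values, and that coordinate is a Boolean term in the coordinates of the
   arguments.  The family separates the points of B, so the induced map into
   the product is injective, hence a monomorphism. *)
Require Import Defs.
From mathcomp Require Import all_boot all_order.
From mathcomp Require Import boolp classical_sets.

Set Implicit Arguments.
Unset Strict Implicit.
Unset Printing Implicit Defensive.

Import Order.Theory.
Local Open Scope order_scope.

Section BooleanMorphism.
Context {d d' : Order.disp_t}.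

(* MathComp's {tblmorphism _ -> _} preserves the bounds only. *)
Record boolean_morphism (A : ctbDistrLatticeType d)
    (A' : ctbDistrLatticeType d') := BooleanMorphism {
  bmorph_fun :> A -> A';
  bmorphI : {morph bmorph_fun : x y / x `&` y};
  bmorphC : {morph bmorph_fun : x / ~` x}
}.

Variables (A : ctbDistrLatticeType d) (A' : ctbDistrLatticeType d').
Variable v : boolean_morphism A A'.

Lemma bmorphU : {morph v : x y / x `|` y}.
Proof.
by move=> x y; rewrite -[x `|` y]complK complU bmorphC bmorphI !bmorphC complI
  !complK.
Qed.

Lemma bmorph0 : v \bot = \bot.
Proof. by rewrite -(meetxC \bot) bmorphI bmorphC meetxC. Qed.

Lemma bmorph1 : v \top = \top.
Proof. by rewrite -compl0 bmorphC bmorph0 compl0. Qed.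

Definition map_snap (z : A * A * A) : A' * A' * A' :=
  (v (snap1 z), v (snap2 z), v (snap3 z)).

Lemma map_snap_snapshots z :
  z \in @snapshots d A -> map_snap z \in @snapshots d' A'.
Proof.
move=> /set_mem[z12 z123]; apply/mem_set.
by rewrite /snapshots /map_snap /snap1 /snap2 /snap3 /= -bmorphU -!bmorphI
  z12 z123 bmorph0 bmorph1.
Qed.

Lemma value1_map_snap c (a : (arity c).-tuple (A * A * A)) :
  value1 (map_tuple map_snap a) = v (value1 a).
Proof.
by case: c a => a; rewrite /= ?tnth_map ?bmorphU ?bmorphC ?bmorphI.
Qed.

Definition map_swap (B : swap_structure A) (z : swap_dom B) :
    swap_dom (full_swap_structure A') :=
  SigSub (map_snap_snapshots (mem_set (swap_dom_sub (set_valP z)))).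

Lemma map_swap_mop (B : swap_structure A) c
    (a : (arity c).-tuple (domain B)) (u : B) :
  mop a u ->
  mop (m := full_swap_structure A') (map_tuple (@map_swap B) a) (map_swap u).
Proof.
move=> /swap_mop_value ua; rewrite /= /full_mop /=.
have -> : map_tuple val (map_tuple (@map_swap B) a) =
          map_tuple map_snap (map_tuple val a).
  by apply: eq_from_tnth => i; rewrite !tnth_map.
by rewrite value1_map_snap -ua.
Qed.

End BooleanMorphism.

Section Ultrafilter.
Context {d : Order.disp_t} (A : ctbDistrLatticeType d).

(* Zorn's lemma is applied to the filters, possibly empty, all of whose
   elements meet [c]: demanding [c] itself would exclude the union of the empty
   chain. *)
Lemma ultrafilter_exists (c : A) : c != \bot ->
  exists F : set A, [/\ F c,
    forall x y, F (x `&` y) <-> F x /\ F y &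
    forall x, F (~` x) <-> ~ F x].
Proof.
move=> c0.
pose P (F : set A) := [/\ forall x y, F x -> F y -> F (x `&` y),
  forall x y, F x -> x <= y -> F y & forall x, F x -> x `&` c != \bot].
have [C CP Ctot|F [[FI Fup Fc] Fmax]] := @Zorn_bigcup A P.
  split=> [x y [X CX Xx] [Y CY Yy]|x y [X CX Xx] xy|x [X CX Xx]].
  - have [XY|YX] := Ctot _ _ CX CY.
      by exists Y => //; have [+ _ _] := CP _ CY; apply => //; exact: XY.
    by exists X => //; have [+ _ _] := CP _ CX; apply => //; exact: YX.
  - by exists X => //; have [_ + _] := CP _ CX; apply; [exact: Xx|].
  - by have [_ _ +] := CP _ CX; apply.
(* Maximality of [F] enters here. The alternative [y = \top] covers the case, not yet excluded, that
   [F] is empty. *)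
have notinF x : ~ F x -> exists2 y, F y \/ y = \top & y `&` x `&` c = \bot.
  move=> Fx; apply: contrapT => noy.
  (* This is the filter generated by [F] and [x]. If no such [y] existed, all its elements would
     meet [c], and it would properly extend [F]. *)
  pose G := [set z | exists2 y, F y \/ y = \top & (y `&` x <= z)%O]%classic.
  apply: (Fmax G).
    rewrite properEneq; split; last first.
      by move=> z Fz; exists z; [left|exact: leIl].
    apply/eqP => FG; apply: Fx; rewrite FG.
    by exists \top; [right|exact: leIr].
  split=> [z t [y Fy yz] [w Fw wt]|z t [y Fy yz] zt|z [y Fy yz]].
  - exists (y `&` w); last first.
      by rewrite -[x]meetxx meetACA leI2.
    case: Fy Fw => [Fy|->] [Fw|->]; rewrite ?meet1x ?meetx1; [|by left|by left|by right].
    by left; exact: FI.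
  - by exists y => //; exact: le_trans zt.
  - apply/eqP => zc; apply: noy; exists y => //.
    by apply/eqP; rewrite -lex0 -zc leI2.
have F1 : F \top.
  apply: contrapT => /notinF[y [Fy|->]]; rewrite meetx1.
    by apply/eqP; exact: Fc.
  by rewrite meet1x; exact/eqP.
have {}notinF x : ~ F x -> exists2 y, F y & y `&` x `&` c = \bot.
  by move=> /notinF[y [Fy|->] yxc]; [exists y|exists \top].
exists F; split.
- apply: contrapT => /notinF[y Fy]; rewrite -meetA meetxx.
  by apply/eqP; exact: Fc.
- move=> x y; split=> [Fxy|[]]; last exact: FI.
  by split; apply: Fup Fxy _; [exact: leIl|exact: leIr].
- move=> x; split=> [FCx Fx|Fx].
    by have := Fc _ (FI _ _ Fx FCx); rewrite meetxC meet0x eqxx.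
  apply: contrapT => FCx.
  (* The meet of [y], [w] and [c] splits along [x] and its complement: one piece lies below the meet
     of [y], [x] and [c], the other below that of [w], the complement of [x] and [c]. Both bounds
     are [\bot], although [F] contains the meet of [y] and [w]. *)
  have [y Fy yxc] := notinF _ Fx; have [w Fw wxc] := notinF _ FCx.
  have /eqP := Fc _ (FI _ _ Fy Fw); apply.
  apply/eqP; rewrite -lex0 -[leLHS]meetx1 -(joinxC x) meetUr leUx.
  rewrite -{1}yxc -wxc !(meetAC _ c); apply/andP.
  by split; do 2!apply: leI2 => //; rewrite ?leIl ?leIr.
Qed.

(** If [x] is not below [y], the meet of [x] with the complement of [y] is nonzero. The indicator
    function of an ultrafilter containing it sends [x] to true and [y] to false. *)
Lemma boolean_morphism_separates (x y : A) : x != y ->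
  exists v : boolean_morphism A bool, v x != v y.
Proof.
(* By antisymmetry one of the two inequalities fails, and the conclusion is symmetric in [x] and
   [y]. *)
wlog xy : x y / ~~ (x <= y).
  move=> sep xNy; have [xy|] := boolP (x <= y); last by move/sep; exact.
  have [||v] := sep y x; last by rewrite eq_sym; exists v.
    by apply: contra xNy => yx; rewrite eq_le xy yx.
  by rewrite eq_sym.
move=> _; have [|F [Fc FI FC]] := @ultrafilter_exists (x `&` ~` y).
  by rewrite -diffE diff_eq0.
have vI : {morph (fun z => `[< F z >]) : z t / z `&` t}.
  by move=> z t; rewrite (propext (FI z t)) asbool_and.
have vC : {morph (fun z => `[< F z >]) : z / ~` z}.
  by move=> z; rewrite (propext (FC z)) asbool_neg.
have [Fx /FC Fy] := (FI _ _).1 Fc.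
by exists (BooleanMorphism vI vC); rewrite /= (asboolT Fx) (asboolF Fy).
Qed.

End Ultrafilter.

Lemma injective_monomorphism (A B : multialgebra) (h : mhom A B) :
  injective h -> monomorphism h.
Proof. by move=> h_inj C f g hfg x; exact/h_inj/hfg. Qed.

Theorem theorem7p6 (d : Order.disp_t) (A : ctbDistrLatticeType d)
    (B : swap_structure A) :
  exists (I : Type) (h : mhom B (mprod (fun _ : I => full_swap_structure bool))),
    monomorphism h.
Proof.
(* For the one-element algebra [I] is empty and the product is a single point, as is [B]. *)
pose I := boolean_morphism A bool.
pose P := mprod (fun _ : I => full_swap_structure bool).
pose h (z : B) : P := fun v => map_swap v z.
have h_mop c (a : (arity c).-tuple B) : (h @` mop a `<=` mop (map_tuple h a))%classic.
  move=> _ [u au <-] v.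
  have -> : map_tuple (fun y : P => y v) (map_tuple h a) =
            map_tuple (@map_swap _ _ _ _ v B) a.
    by apply: eq_from_tnth => i; rewrite !tnth_map.
  exact: map_swap_mop.
exists I, (MHom h_mop); apply: injective_monomorphism => z w /= hzw.
have vzw (v : I) : map_snap v (val z) = map_snap v (val w).
  by have /(congr1 (fun f : P => val (f v))) := hzw.
apply: val_inj.
(* Points are separated in [A], so the triples are compared one coordinate [p] at a time. *)
have sep (p : A * A * A -> A) :
    (forall v : I, v (p (val z)) = v (p (val w))) -> p (val z) = p (val w).
  move=> vp; apply/eqP; apply: contraT => /boolean_morphism_separates[v].
  by rewrite vp eqxx.
rewrite [LHS]surjective_pairing [RHS]surjective_pairing.
rewrite [(val z).1]surjective_pairing [(val w).1]surjective_pairing.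
congr (_, _, _).
- by apply: (sep (@snap1 _ A)) => v; case: (vzw v).
- by apply: (sep (@snap2 _ A)) => v; case: (vzw v).
- by apply: (sep (@snap3 _ A)) => v; case: (vzw v).
Qed.
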